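(* Let $\alpha \ge 2$ be an integer. Then: (i) every finite simple graph $G$ with vertex-edge diameter $d_{ve}(G)=2$ and independence number $\alpha(G)=\alpha$ satisfies $P(G) \le \alpha+2$, and there exists a graph of diameter $2$ (and vertex-edge diameter $2$) with independence number $\alpha$ and pegging number exactly $\alpha+2$; thus the maximum pegging number of graphs of vertex-edge diameter $2$ and independence number $\alpha$ is $\alpha+2$; (ii) if $G$ has $d_{ve}(G)=2$ and $\alpha(G)=\alpha$, then for every distribution of at least $\alpha+2$ pegs on $G$ and every vertex $t$, a peg can be placed on $t$ using at most $3$ pegging moves; (iii) if $G$ has $d_{ve}(G)=2$, $\alpha(G)=\alpha$ and $P(G)=\alpha+2$, then $G$ contains the graph $A$ below as an induced subgraph; and if moreover $G$ has diameter $2$, then $G$ contains the graph $B$ below as an induced subgraph. Here $A$ is the graph on vertices $t,u_1,u_2,v_1,v_2,v_3$ whose edges are exactly $v_1v_2, v_1v_3, v_2v_3, u_1v_1, u_2v_2, u_1u_2, tu_1, tu_2$; and $B$ is obtained from $A$ by adding one vertex $u_3$ adjacent to exactly $t, v_3, u_1, u_2$.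
   Context: All graphs are finite and simple. A graph is non-null if it has at least one edge. The distance between a vertex $x$ and an edge $e$ is the minimum distance from $x$ to an endpoint of $e$; the vertex-edge diameter $d_{ve}(G)$ of a non-null graph $G$ is the maximum distance between a vertex and an edge of $G$. $\alpha(G)$ denotes the independence number. A distribution of pegs on $G$ is a subset $D \subseteq V(G)$. If $u,v \in D$ are distinct adjacent vertices and $w \notin D$ is a vertex adjacent to $v$, the pegging move (jumping $u$ over $v$ into $w$) replaces $D$ by $(D\setminus\{u,v\})\cup\{w\}$. A vertex $t$ is reachable from $D$ if some finite (possibly empty) sequence of pegging moves starting from $D$ ends in a distribution containing $t$; $\mathrm{Reach}(D)$ is the set of reachable vertices. The pegging number $P(G)$ is the smallest positive integer $d$ such that every distribution of size $d$ on $G$ has reach $V(G)$. *)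

(* Defs.v *)
From mathcomp Require Import all_boot.

Set Implicit Arguments.
Unset Strict Implicit.
Unset Printing Implicit Defensive.

Record sgraph := SGraph {
  vertex :> finType;
  adj : rel vertex;
  adj_sym : symmetric adj;
  adj_irr : irreflexive adj }.

Definition is_min (S : nat -> Prop) (n : nat) : Prop :=
  S n /\ forall m, S m -> n <= m.

Definition is_max (S : nat -> Prop) (n : nat) : Prop :=
  S n /\ forall m, S m -> m <= n.

Section Graphs.
Variable G : sgraph.
Implicit Types (x y a b t u v w : G) (D : {set G}) (n : nat).

Definition walk x y n : Prop :=
  exists p : seq G, [/\ path (@adj G) x p, last x p = y & size p = n].

(* Distances are relations because they may be infinite: [dist x y n] holds
   for no n when x and y lie in different components. *)
Definition dist x y n : Prop := is_min (walk x y) n.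

(* The distance from x to the edge ab. *)
Definition ve_dist x a b n : Prop :=
  is_min (fun m => dist x a m \/ dist x b m) n.

(* A maximum is n only if all the distances involved are finite, so both
   diameter predicates force G to be connected; [has_ve_diameter] also forces G
   to have an edge. *)
Definition has_diameter n : Prop :=
  (forall x y, exists m, dist x y m) /\
  is_max (fun m => exists x y, dist x y m) n.

Definition has_ve_diameter n : Prop :=
  (forall x a b, adj a b -> exists m, ve_dist x a b m) /\
  is_max (fun m => exists x a b, adj a b /\ ve_dist x a b m) n.

Definition independent (S : {set G}) : bool :=
  [forall x in S, forall y in S, ~~ adj x y].

Definition independence_number : nat :=
  \max_(S : {set G} | independent S) #|S|.

Definition peg_move : rel {set G} := fun D D' =>
  [exists u in D, exists v in D, exists w,
    [&& u != v, adj u v, w \notin D, adj v w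
      & D' == w |: (D :\: [set u; v])]].

Definition reach D : {set G} :=
  [set t | [exists D', connect peg_move D D' && (t \in D')]].

Definition reachable_within t D n : Prop :=
  exists s : seq {set G},
    [/\ path peg_move D s, size s <= n & t \in last D s].

Definition pegging_bound n : bool :=
  (0 < n) && [forall D : {set G}, (#|D| == n) ==> (reach D == [set: G])].

Lemma pegging_bound_exists : exists n, pegging_bound n.
Proof.
exists #|G|.+1; apply/andP; split=> //; apply/forallP=> D.
by apply/implyP=> /eqP cD; have := max_card D; rewrite cD ltnn.
Qed.

Definition pegging_number : nat := ex_minn pegging_bound_exists.

End Graphs.

Definition induced_subgraph (H G : sgraph) : Prop :=
  exists f : H -> G, injective f /\ forall x y, adj (f x) (f y) = adj x y.

Section EdgeList.
Variables (n : nat) (E : seq (nat * nat)).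

Definition edge_rel : rel 'I_n := fun i j =>
  (i != j) && (((i : nat, j : nat) \in E) || ((j : nat, i : nat) \in E)).

Lemma edge_rel_sym : symmetric edge_rel.
Proof. by move=> i j; rewrite /edge_rel eq_sym orbC. Qed.

Lemma edge_rel_irr : irreflexive edge_rel.
Proof. by move=> i; rewrite /edge_rel eqxx. Qed.

Definition graph_of_edges : sgraph := SGraph edge_rel_sym edge_rel_irr.
End EdgeList.

(* Vertices: t = 0, u1 = 1, u2 = 2, v1 = 3, v2 = 4, v3 = 5. *)
Definition edgesA : seq (nat * nat) :=
  [:: (3, 4); (3, 5); (4, 5); (1, 3); (2, 4); (1, 2); (0, 1); (0, 2)].

Definition graphA : sgraph := graph_of_edges 6 edgesA.

(* The additional vertex is u3 = 6. *)
Definition graphB : sgraph :=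
  graph_of_edges 7 (edgesA ++ [:: (6, 0); (6, 5); (6, 1); (6, 2)]).

(* Main.v *)
Require Import Defs.
From mathcomp Require Import all_boot.

Set Implicit Arguments.
Unset Strict Implicit.
Unset Printing Implicit Defensive.

(** Vertex-edge diameter at most 2 is used twice.  If a peg [x] is adjacent to the
    target [t] and two pegs are adjacent, then applying it to [x] and that edge
    of pegs puts a second peg next to [x] in one move, and [t] is reached by the
    next one.  Applied to [t] and an edge [uv] of pegs, it lets us jump to a
    neighbour [w] of [t]; with [alpha + 2] pegs the remaining [alpha + 1] still
    contain an edge, so three moves suffice.

    If [alpha + 1] pegs fail to reach [t], each such jump must therefore leave an
    independent set, and no peg is adjacent to [t].  Hence any two edges of pegs
    meet, and replacing any one peg by [t] leaves an edge, so the edges of pegs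
    form a triangle.  The links [w] from two of its vertices to [t] are adjacent,
    since otherwise swapping these vertices for their links would give
    [alpha + 1] independent vertices: this is [graphA], and in diameter 2 all
    three vertices have a link, which gives [graphB]. *)

(** * Distance at most 2 and the two diameters *)

Section Distances.
Variable G : sgraph.
Implicit Types (x y z a b : G).

Definition near2 x y : Prop :=
  [\/ x = y, adj x y | exists2 z, adj x z & adj z y].

Definition edges_near2 : Prop :=
  forall x a b, adj a b -> near2 x a \/ near2 x b.

Lemma walk_near2 x y m : walk x y m -> m <= 2 -> near2 x y.
Proof.
case=> [[|z [|z' [|? ?]]]] [] /= => [_ <- _ _|/andP[xz _] <- _ _||_ _ <- //].
- exact: Or31.
- exact: Or32.
- by case/and3P=> xz zz' _ <- _ _; apply: Or33; exists z.
Qed.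

Lemma ve_diameter2_near : has_ve_diameter G 2 -> edges_near2.
Proof.
case=> ex [_ le2] x a b ab; have [m xm] := ex x a b ab.
have m2 : m <= 2 by apply: le2; exists x, a, b.
case: xm => -[] [xw _] _; [left|right]; exact: walk_near2 xw m2.
Qed.

Lemma diameter2_near x y : has_diameter G 2 -> near2 x y.
Proof.
case=> ex [_ le2]; have [m xm] := ex x y.
have m2 : m <= 2 by apply: le2; exists x, y.
by case: xm => xw _; apply: walk_near2 xw m2.
Qed.

Lemma near2_dist x y : near2 x y -> exists2 m, dist x y m & m <= 2.
Proof.
have [<-|nxy] := eqVneq x y.
  by exists 0 => //; split=> //; exists [::].
have walk0 m : walk x y m -> 0 < m.
  by case=> -[|? ?] [] //= _ xy <- //; rewrite xy eqxx in nxy.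
have [xy|nadj] := boolP (adj x y).
  exists 1 => //; split; last exact: walk0.
  by exists [:: y]; split=> //=; rewrite xy.
case=> [xy|xy|[z xz zy]]; [by rewrite xy eqxx in nxy|by rewrite xy in nadj|].
exists 2 => //; split; first by exists [:: z; y]; split=> //=; rewrite xz zy.
move=> m xm; have := walk0 _ xm; case: m xm => [|[|m]] // + _.
case=> -[|w [|? ?]] [] //=; rewrite andbT => xw wy.
by rewrite -wy xw in nadj.
Qed.

Lemma dist_fun x y m n : dist x y m -> dist x y n -> m = n.
Proof.
by case=> xm lem [xn len]; apply/eqP; rewrite eqn_leq lem // len.
Qed.

Lemma far_dist x y m : dist x y m -> x != y -> ~~ adj x y -> 1 < m.
Proof.
case=> -[p [xp py <-]] _; case: p xp py => [|z [|? ?]] //=.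
  by move=> _ -> /eqP.
by rewrite andbT => xz <-; rewrite xz.
Qed.

Lemma near2_diameter x0 y0 :
  (forall x y, near2 x y) -> x0 != y0 -> ~~ adj x0 y0 -> has_diameter G 2.
Proof.
move=> near ne nadj; split=> [x y|].
  by have [m xm _] := near2_dist (near x y); exists m.
split=> [|m [x [y xm]]].
  exists x0, y0; have [m xm m2] := near2_dist (near x0 y0).
  suff -> : 2 = m by [].
  by apply/eqP; rewrite eqn_leq m2 (far_dist xm).
by have [n xn n2] := near2_dist (near x y); rewrite (dist_fun xm xn).
Qed.

Lemma ve_dist_minn x a b m n :
  dist x a m -> dist x b n -> ve_dist x a b (minn m n).
Proof.
move=> xa xb; split; first by case: leqP => _; [left|right].
move=> p [xp|xp]; first by rewrite (dist_fun xp xa) geq_minl.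
by rewrite (dist_fun xp xb) geq_minr.
Qed.

Lemma near2_ve_diameter x0 a0 b0 :
  (forall x y, near2 x y) -> adj a0 b0 ->
  x0 != a0 -> ~~ adj x0 a0 -> x0 != b0 -> ~~ adj x0 b0 ->
  has_ve_diameter G 2.
Proof.
move=> near ab0 nea na neb nb.
have ve x a b : exists2 m, ve_dist x a b m & m <= 2.
  have [m xa m2] := near2_dist (near x a).
  have [n xb n2] := near2_dist (near x b).
  by exists (minn m n); [apply: ve_dist_minn | rewrite geq_min m2].
split=> [x a b _|]; first by have [m xm _] := ve x a b; exists m.
split=> [|m [x [a [b [_ [xm lem]]]]]].
  exists x0, a0, b0; split=> //; have [m xm m2] := ve x0 a0 b0.
  suff -> : 2 = m by [].
  apply/eqP; rewrite eqn_leq m2 andbT.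
  by case: xm => -[xm|xm] _; apply: (far_dist xm).
have [n [xn _] n2] := ve x a b; apply: leq_trans n2; exact: lem.
Qed.

End Distances.

(** * Independent sets, pegging moves, and targets reached in three moves *)

Section Pegging.
Variable G : sgraph.
Implicit Types (x y a b s t u v w : G) (D : {set G}).

Lemma adj_neq u v : adj u v -> u != v.
Proof. by apply: contraTneq => ->; rewrite adj_irr. Qed.

Lemma independentP D :
  reflect {in D &, forall x y, ~~ adj x y} (independent D).
Proof.
apply: (iffP forall_inP) => H x; last by move=> xD; apply/forall_inP=> y; apply: H.
by move=> y /H/forall_inP; apply.
Qed.

Lemma independentPn D :
  reflect (exists a b, [/\ a \in D, b \in D & adj a b]) (~~ independent D).
Proof.
apply: (iffP idP) => [|[a [b [aD bD ab]]]]; last first.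
  by apply/independentP=> /(_ a b aD bD); rewrite ab.
rewrite negb_forall_in => /exists_inP[a aD]; rewrite negb_forall_in.
by case/exists_inP=> b bD /negPn ab; exists a, b.
Qed.

Lemma sub_independent D D' : D' \subset D -> independent D -> independent D'.
Proof.
move=> /subsetP sD /independentP indD; apply/independentP=> x y /sD xD /sD yD.
exact: indD.
Qed.

Lemma independentU1 x D :
  independent D -> {in D, forall y, ~~ adj x y} -> independent (x |: D).
Proof.
move=> /independentP indD xD; apply/independentP=> y z.
case/setU1P=> [->|yD] /setU1P[->|zD]; rewrite ?adj_irr //.
- exact: xD.
- by rewrite adj_sym xD.
- exact: indD.
Qed.

Lemma independent_card D : independent D -> #|D| <= independence_number G.
Proof. exact: leq_bigmax_cond. Qed.

Lemma dependent_card D :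
  independence_number G < #|D| -> exists a b, [/\ a \in D, b \in D & adj a b].
Proof.
move=> ltD; apply/independentPn; apply: contraL ltD => /independent_card.
by rewrite leqNgt.
Qed.

Lemma peg_moveI D u v w :
  u \in D -> v \in D -> adj u v -> w \notin D -> adj v w ->
  peg_move D (w |: (D :\: [set u; v])).
Proof.
move=> uD vD uv wD vw; apply/exists_inP; exists u => //.
apply/exists_inP; exists v => //; apply/existsP; exists w.
by rewrite adj_neq // uv wD vw eqxx.
Qed.

Lemma peg_moveE D D' : peg_move D D' ->
  exists u v w, [/\ u \in D, v \in D, adj u v, w \notin D & adj v w]
    /\ D' = w |: (D :\: [set u; v]).
Proof.
case/exists_inP=> u uD /exists_inP[v vD /existsP[w]].
by case/and5P=> _ uv wD vw /eqP->; exists u, v, w.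
Qed.

Lemma card_peg_move D u v w :
  u \in D -> v \in D -> adj u v -> w \notin D ->
  #|w |: (D :\: [set u; v])| = #|D|.-1.
Proof.
move=> uD vD uv wD; rewrite cardsU1 !inE (negPf wD) andbF add1n cardsD.
have /setIidPr-> : [set u; v] \subset D.
  by apply/subsetP=> x /set2P[]->.
have : #|[set u; v]| <= #|D|.
  by apply/subset_leq_card/subsetP=> x /set2P[]->.
by rewrite cards2 adj_neq //; case: #|D| => [|[|n]] //= _; rewrite !subSS subn0.
Qed.

Lemma reachable_within_mem t D n : t \in D -> reachable_within t D n.
Proof. by exists [::]. Qed.

Lemma reachable_within_step t D D' n :
  peg_move D D' -> reachable_within t D' n -> reachable_within t D n.+1.
Proof. by move=> DD' [s [ps szs ts]]; exists (D' :: s); rewrite /= DD'. Qed.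

Lemma reachable_within_leq t D m n :
  m <= n -> reachable_within t D m -> reachable_within t D n.
Proof. by move=> mn [s [ps szs ts]]; exists s; rewrite (leq_trans szs). Qed.

Lemma reachable_within_reach t D n : reachable_within t D n -> t \in reach D.
Proof.
case=> s [ps _ ts]; rewrite inE; apply/existsP; exists (last D s).
by rewrite ts andbT; apply/connectP; exists s.
Qed.

Lemma reach_jump t D u v :
  u \in D -> v \in D -> adj u v -> adj v t -> reachable_within t D 1.
Proof.
move=> uD vD uv vt; have [tD|tD] := boolP (t \in D).
  exact: reachable_within_mem.
apply: reachable_within_step (peg_moveI uD vD uv tD vt) _.
by apply: reachable_within_mem; rewrite setU11.
Qed.

Hypothesis near : edges_near2 G.

(* The vertex-edge diameter is used at the peg [x], not at the target: an edge
   of pegs brings a second peg next to [x] in at most one move. *)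
Lemma reach_from_neighbor t D x a b :
  x \in D -> adj x t -> a \in D -> b \in D -> adj a b ->
  reachable_within t D 2.
Proof.
move=> xD xt; wlog nxa : a b / near2 x a.
  move=> wl aD bD ab; case: (near x ab) => [nxa|nxb]; first exact: (wl a b).
  by apply: (wl b a) => //; rewrite adj_sym.
move=> aD bD ab; case: nxa => [xa|xa|[s xs sa]].
- apply: (@reachable_within_leq _ _ 1) => //.
  by apply: (reach_jump bD xD) => //; rewrite xa adj_sym.
- apply: (@reachable_within_leq _ _ 1) => //.
  by apply: (reach_jump aD xD) => //; rewrite adj_sym.
have [sD|sD] := boolP (s \in D).
  apply: (@reachable_within_leq _ _ 1) => //.
  by apply: (reach_jump sD xD) => //; rewrite adj_sym.
(* The two-move plan is [b] over [a] into [s], then [s] over [x] into [t]. The first jump must not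
   remove [x], so [x = a] and [x = b] are treated apart; there a single jump suffices. *)
have [xa|nxa] := eqVneq x a.
  apply: (@reachable_within_leq _ _ 1) => //.
  by apply: (reach_jump bD xD) => //; rewrite xa adj_sym.
have [xb|nxb] := eqVneq x b.
  apply: (@reachable_within_leq _ _ 1) => //.
  by apply: (reach_jump aD xD) => //; rewrite xb.
have ba : adj b a by rewrite adj_sym.
have sa' : adj a s by rewrite adj_sym.
apply: reachable_within_step (peg_moveI bD aD ba sD sa') _.
apply: (@reach_jump _ _ s x) => //; rewrite ?setU11 // 1?adj_sym //.
by rewrite !inE (negPf nxa) (negPf nxb) xD orbT.
Qed.

(** The jump of [u] over [v] puts a peg on [w], next to [t]; any edge of pegs in the new position
    then gives [t] in two more moves. *)
Lemma reach_or_independent t D u v w :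
  u \in D -> v \in D -> adj u v -> adj v w -> adj w t ->
  reachable_within t D 3 \/
  w \notin D /\ independent (w |: (D :\: [set u; v])).
Proof.
move=> uD vD uv vw wt; have [wD|wD] := boolP (w \in D).
  left; apply: (@reachable_within_leq _ _ 2) => //.
  exact: (reach_from_neighbor wD wt uD vD uv).
have [ind|/independentPn[a [b [aD bD ab]]]] :=
  boolP (independent (w |: (D :\: [set u; v]))); first by right.
left; apply: reachable_within_step (peg_moveI uD vD uv wD vw) _.
by apply: (reach_from_neighbor _ wt aD bD ab); rewrite setU11.
Qed.

Lemma reach_or_link t D a b :
  a \in D -> b \in D -> adj a b ->
  reachable_within t D 3 \/
  exists w, adj w t /\ (adj a w \/ adj b w).
Proof.
move=> aD bD ab; wlog nta : a b aD bD ab / near2 t a.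
  move=> wl; case: (near t ab) => [nta|ntb]; first exact: (wl a b).
  case: (wl b a) => //; [by rewrite adj_sym|by left|].
  by case=> w [wt wab]; right; exists w; split=> //; case: wab; [right|left].
case: nta => [->|ta|[s ts sa]].
- by left; apply: reachable_within_mem.
- left; apply: (@reachable_within_leq _ _ 1) => //.
  by apply: (reach_jump bD aD); rewrite adj_sym.
by right; exists s; split; [rewrite adj_sym | left; rewrite adj_sym].
Qed.

Lemma reach_in3 t D :
  independence_number G + 2 <= #|D| -> reachable_within t D 3.
Proof.
rewrite addn2 => cD; have [a [b [aD bD ab]]] := dependent_card (ltnW cD).
case: (reach_or_link t aD bD ab) => // -[w [wt vw]].
wlog aw : a b aD bD ab {vw} / adj b w.
  move=> wl; case: vw => [aw|bw]; last exact: (wl a b).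
  by apply: (wl b a) => //; rewrite adj_sym.
case: (reach_or_independent aD bD ab aw wt) => // -[wD /independent_card].
rewrite card_peg_move // => leD.
by move: cD; rewrite -ltn_predRL ltnNge leD.
Qed.

(** * Structure of [alpha + 1] pegs that miss [t] within three moves *)

Section Blocked.
Variables (t : G) (D : {set G}).
Hypothesis blocked : ~ reachable_within t D 3.
Hypothesis cardD : #|D| = (independence_number G).+1.

Lemma blocked_move u v w :
  u \in D -> v \in D -> adj u v -> adj v w -> adj w t ->
  w \notin D /\ independent (w |: (D :\: [set u; v])).
Proof. by move=> uD vD uv vw wt; case: (reach_or_independent uD vD uv vw wt). Qed.

Lemma blocked_link a b :
  a \in D -> b \in D -> adj a b -> exists w, adj w t /\ (adj a w \/ adj b w).
Proof. by move=> aD bD ab; case: (reach_or_link t aD bD ab). Qed.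

Lemma blocked_far d : d \in D -> ~~ adj d t.
Proof.
move=> dD; apply/negP=> dt.
have [|a [b [aD bD ab]]] := @dependent_card D; first by rewrite cardD.
apply: blocked; apply: (@reachable_within_leq _ _ 2) => //.
exact: (reach_from_neighbor dD dt aD bD ab).
Qed.

(** A link to [t] permits a jump along [ab] in one of the two directions; either one removes exactly
    [a] and [b], and what it leaves is independent. *)
Lemma blocked_edges_meet a b :
  a \in D -> b \in D -> adj a b -> independent (D :\: [set a; b]).
Proof.
move=> aD bD ab; have [w [wt [aw|bw]]] := blocked_link aD bD ab.
  rewrite adj_sym in ab; have [_] := blocked_move bD aD ab aw wt.
  by apply: sub_independent; rewrite setUC subsetUr.
have [_] := blocked_move aD bD ab bw wt.
by apply: sub_independent; rewrite subsetUr.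
Qed.

(** Exchanging [a] for [t] keeps [alpha + 1] vertices, hence an edge. It cannot use [t], which has
    no neighbour in [D]. *)
Lemma blocked_edge_avoiding a :
  a \in D -> exists x y, [/\ x \in D, y \in D, adj x y, x != a & y != a].
Proof.
move=> aD; have tD : t \notin D.
  by apply/negP=> tD; apply: blocked; apply: reachable_within_mem.
have [|x [y [xD yD xy]]] := @dependent_card (t |: (D :\ a)).
  by rewrite cardsU1 !inE (negPf tD) andbF -cardD (cardsD1 a D) aD.
move: xD yD; rewrite !inE => /orP[/eqP xt|/andP[xa xD]] /orP[/eqP yt|/andP[ya yD]].
- by rewrite xt yt adj_irr in xy.
- by have := blocked_far yD; rewrite adj_sym -xt xy.
- by have := blocked_far xD; rewrite -yt xy.
by exists x, y.
Qed.

(** An edge of pegs avoiding [a] must still meet [ab], so it passes through [b]. *)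
Lemma blocked_third a b :
  a \in D -> b \in D -> adj a b -> exists c, [/\ c \in D, adj b c & c != a].
Proof.
move=> aD bD ab; have [x [y [xD yD xy xa ya]]] := blocked_edge_avoiding aD.
have [xb|nxb] := eqVneq x b; first by exists y; rewrite -xb.
have [yb|nyb] := eqVneq y b; first by exists x; rewrite -yb adj_sym.
have /independentP/(_ x y) := blocked_edges_meet aD bD ab.
by rewrite !inE (negPf xa) (negPf nxb) (negPf ya) (negPf nyb) xy xD yD => /(_ isT isT).
Qed.

(** Each end of an edge [ab] has a further peg neighbour, [c] for [b] and [d] for [a]. The edges
    [bc] and [ad] must meet, which forces [c = d]. *)
Lemma blocked_triangle :
  exists a b c, [/\ a \in D, b \in D & c \in D] /\ [/\ adj a b, adj b c & adj a c].
Proof.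
have [|a [b [aD bD ab]]] := @dependent_card D; first by rewrite cardD.
have [c [cD bc ca]] := blocked_third aD bD ab.
have ba : adj b a by rewrite adj_sym.
have [d [dD ad db]] := blocked_third bD aD ba.
exists a, b, c; split=> //; split=> //.
have [<-//|cd] := eqVneq d c.
have /independentP/(_ a d) := blocked_edges_meet bD cD bc.
by rewrite !inE ad aD dD (negPf db) (negPf cd) (negPf (adj_neq ab)) eq_sym (negPf ca) => /(_ isT isT).
Qed.

(** Jumping the third vertex [c] over [a] into [w] leaves both [b] and [w] in an independent set. *)
Lemma blocked_link_private a b c w :
  a \in D -> b \in D -> c \in D -> adj a b -> adj b c -> adj a c ->
  adj a w -> adj w t -> ~~ adj b w.
Proof.
move=> aD bD cD ab bc ac aw wt; have ca : adj c a by rewrite adj_sym.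
have [_ /independentP/(_ b w)] := blocked_move cD aD ca aw wt.
by rewrite !inE eqxx bD (negPf (adj_neq bc)) [b == a]eq_sym (negPf (adj_neq ab)) orbT; apply.
Qed.

(** The jumps along [uv] in both directions show that neither [w] nor [w'] has a neighbour among the
    other pegs. If [w] and [w'] were not adjacent either, they would replace [u] and [v] in an
    independent set of size [alpha + 1]. *)
Lemma blocked_links_adj u v w w' :
  u \in D -> v \in D -> adj u v ->
  adj u w -> adj w t -> adj v w' -> adj w' t -> ~~ adj v w -> adj w w'.
Proof.
move=> uD vD uv uw wt vw' w't nvw.
have vu : adj v u by rewrite adj_sym.
have [wD indw] := blocked_move vD uD vu uw wt.
have [w'D indw'] := blocked_move uD vD uv vw' w't.
have nww' : w != w' by apply: contraNneq nvw => ->.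
apply/negPn/negP=> nadj.
suff /independent_card : independent (w |: (w' |: (D :\: [set u; v]))).
  rewrite cardsU1 card_peg_move // cardD !inE (negPf wD) (negPf nww') andbF.
  by rewrite ltnn.
apply: independentU1 => // y /setU1P[->//|yD].
by move/independentP: indw; apply; rewrite ?setU11 // [[set v; u]]setUC setU1r.
Qed.

(** One side of the triangle gives a link at one of its ends; the side opposite that end gives a
    link at another vertex. *)
Lemma blocked_two_links : exists v1 v2 v3 w1 w2,
  [/\ v1 \in D, v2 \in D & v3 \in D] /\ [/\ adj v1 v2, adj v2 v3 & adj v1 v3] /\
  [/\ adj v1 w1, adj w1 t, adj v2 w2 & adj w2 t].
Proof.
have [a [b [c [[aD bD cD] [ab bc ac]]]]] := blocked_triangle.
have [w [wt vw]] := blocked_link aD bD ab.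
wlog aw : a b aD bD ab bc ac {vw} / adj a w.
  by case: vw => aw wl; [apply: (wl a b) | apply: (wl b a); rewrite // adj_sym].
have [w' [w't [bw'|cw']]] := blocked_link bD cD bc.
  by exists a, b, c, w, w'.
by exists a, c, b, w, w'; rewrite (adj_sym c b).
Qed.

End Blocked.
End Pegging.

(** * Induced embeddings of graphs given by edge lists *)

Section EdgeListEmbedding.
Variables (n : nat) (E : seq (nat * nat)).

Definition nat_edge : rel nat := fun i j =>
  (i != j) && (((i, j) \in E) || ((j, i) \in E)).

(** When distinct vertices have distinct neighbourhoods, a map that preserves and reflects adjacency
    is automatically injective. This is checked by computation for the two concrete graphs. *)
Definition twin_free : bool :=
  all (fun i => all (fun j =>
    all (fun k => nat_edge i k == nat_edge j k) (iota 0 n) ==> (i == j))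
    (iota 0 n)) (iota 0 n).

Lemma embed_edges (G : sgraph) (f : nat -> G) :
  twin_free ->
  (forall i j, i < j -> j < n -> adj (f i) (f j) = nat_edge i j) ->
  induced_subgraph (graph_of_edges n E) G.
Proof.
move=> /allP twin adjf.
have adjE (i j : 'I_n) : adj (f i) (f j) = nat_edge i j.
  case: (ltngtP i j) => [ij|ji|->]; first exact: adjf.
    by rewrite adj_sym adjf // /nat_edge eq_sym orbC.
  by rewrite adj_irr /nat_edge eqxx.
exists (fun i : 'I_n => f i); split=> // i j fij; apply/val_inj/eqP.
have in_iota (k : 'I_n) : val k \in iota 0 n by rewrite mem_iota /=.
have /allP/(_ _ (in_iota j))/implyP := twin _ (in_iota i); apply.
apply/allP=> k; rewrite mem_iota => /= kn.
by rewrite -!(adjE _ (Ordinal kn)) fij.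
Qed.

End EdgeListEmbedding.

(** * The upper bound and the forced induced subgraphs *)

Lemma pegging_number_leq (G : sgraph) :
  edges_near2 G -> pegging_number G <= independence_number G + 2.
Proof.
move=> near; rewrite /pegging_number; case: ex_minnP => p _; apply.
rewrite /pegging_bound addn2; apply/forallP=> D; apply/implyP=> /eqP cD.
apply/eqP/setP=> t; rewrite in_setT; apply: (@reachable_within_reach _ _ _ 3).
by apply: reach_in3; rewrite // addn2 cD.
Qed.

Lemma pegging_number_blocked (G : sgraph) n :
  n.+1 < pegging_number G ->
  exists (D : {set G}) t, #|D| = n.+1 /\ t \notin reach D.
Proof.
rewrite /pegging_number; case: ex_minnP => p _ minp ltnp.
have : ~~ pegging_bound G n.+1 by apply: contraL ltnp => /minp; rewrite leqNgt.
rewrite negb_forall => /existsP[D]; rewrite negb_imply => /andP[/eqP cD nr].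
have : ~~ ([set: G] \subset reach D) by rewrite subTset.
by case/subsetPn=> t _ tD; exists D, t.
Qed.

Lemma contains_AB (G : sgraph) :
  edges_near2 G -> pegging_number G = independence_number G + 2 ->
  induced_subgraph graphA G /\
  ((forall x y : G, near2 x y) -> induced_subgraph graphB G).
Proof.
move=> near pG; have [|D [t [szD tD]]] := @pegging_number_blocked G (independence_number G).
  by rewrite pG addn2.
have blocked : ~ reachable_within t D 3 by move/reachable_within_reach; apply/negP.
have [v1 [v2 [v3 [u1 [u2 [[D1 D2 D3] [[v12 v23 v13] [vu1 ut1 vu2 ut2]]]]]]]] :=
  blocked_two_links near blocked szD.
have far d : d \in D -> adj t d = false.
  by move=> dD; apply/negbTE; rewrite adj_sym (blocked_far near blocked).
have v21 : adj v2 v1 by rewrite adj_sym.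
have v32 : adj v3 v2 by rewrite adj_sym.
have v31 : adj v3 v1 by rewrite adj_sym.
(* Non-adjacency is restated as a rewrite rule with the link first, the order in which the vertices
   are enumerated for [graphA]. *)
have priv a b c w : a \in D -> b \in D -> c \in D -> adj a b -> adj b c ->
  adj a c -> adj a w -> adj w t -> adj w b = false.
  move=> aD bD cD ab bc ac aw wt; apply/negbTE; rewrite adj_sym.
  exact: (blocked_link_private near blocked aD bD cD ab bc ac aw wt).
have links u v w w' : u \in D -> v \in D -> adj u v -> adj u w -> adj w t ->
  adj v w' -> adj w' t -> adj w v = false -> adj w w'.
  move=> uD vD uv uw wt vw' w't /negbT; rewrite adj_sym.
  exact: (blocked_links_adj near blocked szD uD vD uv uw wt vw' w't).
have n12 := priv v1 v2 v3 u1 D1 D2 D3 v12 v23 v13 vu1 ut1.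
have n13 := priv v1 v3 v2 u1 D1 D3 D2 v13 v32 v12 vu1 ut1.
have n21 := priv v2 v1 v3 u2 D2 D1 D3 v21 v13 v23 vu2 ut2.
have n23 := priv v2 v3 v1 u2 D2 D3 D1 v23 v31 v21 vu2 ut2.
have u12 := links v1 v2 u1 u2 D1 D2 v12 vu1 ut1 vu2 ut2 n12.
have [tu1 tu2] : adj t u1 /\ adj t u2 by rewrite !(adj_sym t).
have [uv1 uv2] : adj u1 v1 /\ adj u2 v2 by rewrite adj_sym (adj_sym u2).
split=> [|near_all].
  apply: (@embed_edges _ _ _ (nth t [:: t; u1; u2; v1; v2; v3])) => //.
  by move=> [|[|[|[|[|[|i]]]]]] [|[|[|[|[|[|j]]]]]] //= _ _;
    rewrite ?far ?n12 ?n13 ?n21 ?n23.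
(* Diameter 2 enters here: [v3] is a peg, so it is neither [t] nor adjacent to [t], and a common
   neighbour serves as [u3]. *)
have [tv3|tv3|[u3 tu3 uv3]] := near_all t v3.
- by case: blocked; apply: reachable_within_mem; rewrite tv3.
- by rewrite far in tv3.
have ut3 : adj u3 t by rewrite adj_sym.
have vu3 : adj v3 u3 by rewrite adj_sym.
have n31 := priv v3 v1 v2 u3 D3 D1 D2 v31 v12 v32 vu3 ut3.
have n32 := priv v3 v2 v1 u3 D3 D2 D1 v32 v21 v31 vu3 ut3.
have u13 := links v1 v3 u1 u3 D1 D3 v13 vu1 ut1 vu3 ut3 n13.
have u23 := links v2 v3 u2 u3 D2 D3 v23 vu2 ut2 vu3 ut3 n23.
have [m31 m32] : adj v1 u3 = false /\ adj v2 u3 = false.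
  by rewrite adj_sym n31 adj_sym n32.
apply: (@embed_edges _ _ _ (nth t [:: t; u1; u2; v1; v2; v3; u3])) => //.
by move=> [|[|[|[|[|[|[|i]]]]]]] [|[|[|[|[|[|[|j]]]]]]] //= _ _;
  rewrite ?far ?n12 ?n13 ?n21 ?n23 ?m31 ?m32.
Qed.

(** * A graph with independence number [k + 2] attaining the bound *)

Section Extremal.
Variable k : nat.

Definition lower : finType := option ('I_3 + 'I_k)%type.

Definition lower_adj (i j : lower) : bool :=
  match i, j with
  | None, None => false
  | Some i', Some j' => if (i', j') is (inl p, inl q) then p != q else false
  | _, _ => true
  end.

Definition extremal_vertex : finType := (lower + option lower)%type.

(* The target [inr None] and the mates [inr (Some j)] of the lower vertices form
   a clique, and [inl j] is joined to its mate.  In the lower part a hub [None]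
   dominates a triangle [inl _] and [k] independent vertices [inr _]. *)
Definition extremal_adj : rel extremal_vertex := fun x y =>
  match x, y with
  | inl i, inl j => lower_adj i j
  | inl i, inr (Some j) | inr (Some j), inl i => i == j
  | inr a, inr b => a != b
  | _, _ => false
  end.

Lemma extremal_adj_sym : symmetric extremal_adj.
Proof.
by case=> [[[p|p]|]|[i|]] [[[q|q]|]|[j|]] //=; rewrite eq_sym.
Qed.

Lemma extremal_adj_irr : irreflexive extremal_adj.
Proof. by case=> [[[p|q]|]|[a|]] //=; rewrite eqxx. Qed.

Definition extremal : sgraph := SGraph extremal_adj_sym extremal_adj_irr.

Lemma adj_upper a b : adj (inr a : extremal) (inr b) = (a != b).
Proof. by case: a. Qed.

Let target : extremal := inr None.

(** Lower vertices meet through the hub, a lower vertex reaches the upper clique through its mate,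
    and upper vertices are pairwise adjacent. *)
Lemma extremal_near2 (x y : extremal) : near2 x y.
Proof.
have lower_mate (i : lower) (a : option lower) : near2 (inl i : extremal) (inr a).
  have [<-|ne] := eqVneq (Some i) a; first by apply: Or32; rewrite /= eqxx.
  by apply: Or33; exists (inr (Some i) : extremal); rewrite //= ?eqxx.
case: x y => [i|a] [j|b].
- case: i j => [i|] [j|]; [|by apply: Or32|by apply: Or32|by apply: Or31].
  by apply: Or33; exists (inl None : extremal).
- exact: lower_mate.
- case: (lower_mate j a) => [//|ja|[z jz za]].
    by apply: Or32; rewrite adj_sym.
  by apply: Or33; exists z; rewrite adj_sym.
by have [->|ab] := eqVneq a b; [apply: Or31 | apply: Or32; rewrite adj_upper].
Qed.

Lemma extremal_diameter : has_diameter extremal 2.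
Proof.
by apply: (@near2_diameter _ target (inl None)) => //; apply: extremal_near2.
Qed.

Lemma extremal_ve_diameter : has_ve_diameter extremal 2.
Proof.
pose v i : extremal := inl (Some (inl (inord i))).
(* The target has no lower neighbour, so any lower edge is at distance 2 from it; a side of the
   triangle is taken. *)
apply: (@near2_ve_diameter _ target (v 0) (v 1)) => //; first exact: extremal_near2.
by rewrite /= -val_eqE /= !inordK.
Qed.

(** A cover by [k + 2] cliques: the upper part, the hub with its triangle, and [k] single vertices.
    It bounds the independence number from above. *)
Definition clique_color (x : extremal) : option (option 'I_k) :=
  match x with
  | inl (Some (inr i)) => Some (Some i)
  | inl _ => Some None
  | inr _ => None
  end.

Lemma clique_color_adj (x y : extremal) :
  clique_color x = clique_color y -> x = y \/ adj x y.
Proof.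
case: x y => [[[p|p]|]|a] [[[q|q]|]|b] //; try by [left|right].
- by case: (eqVneq p q) => [->|ne] _; [left|right].
- by case=> ->; left.
- by case: (eqVneq a b) => [->|ne] _; [left|right; rewrite adj_upper].
Qed.

Lemma extremal_independence : independence_number extremal = k.+2.
Proof.
apply/eqP; rewrite eqn_leq; apply/andP; split.
  apply/bigmax_leqP=> I /independentP indI.
  have -> : #|I| = #|clique_color @: I|.
    rewrite card_in_imset // => x y xI yI /clique_color_adj[//|xy].
    by have := indI x y xI yI; rewrite xy.
  by apply: leq_trans (max_card _) _; rewrite !card_option card_ord.
(* One vertex from each clique, avoiding the hub and the mates, so that no two are adjacent. *)
pose rep (c : option (option 'I_k)) : extremal :=
  match c with
  | Some (Some i) => inl (Some (inr i))
  | Some None => inl (Some (inl ord0))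
  | None => target
  end.
have rep_inj : injective rep by move=> [[i|]|] [[j|]|] //= [->].
have <- : #|rep @: [set: option (option 'I_k)]| = k.+2.
  by rewrite card_imset // cardsT !card_option card_ord.
apply: independent_card; apply/independentP=> x y /imsetP[c _ ->] /imsetP[d _ ->].
by case: c d => [[i|]|] [[j|]|].
Qed.

(* In a distribution of lower pegs whose edges pairwise meet, a move leaves an
   independent set plus one peg [w]: if [w] is lower, all new edges meet at [w];
   if [w] is a mate, its lower neighbour was just removed and the position is
   stuck. *)
Definition safe (D : {set extremal}) : Prop :=
  target \notin D /\
  (independent D \/
   (forall a, inr a \notin D) /\
   {in D &, forall u v, adj u v -> independent (D :\: [set u; v])}).

Lemma safe_move D D' : safe D -> peg_move D D' -> safe D'.
Proof.
move=> [tD safeD] /peg_moveE[u [v [w [[uD vD uv wD vw] ->]]]].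
case: safeD => [/independentP/(_ u v uD vD)|[lowD meet]]; first by rewrite uv.
have indR := meet u v uD vD uv.
case: v vD uv vw meet indR => [j|a] vD; last by rewrite (negPf (lowD a)) in vD.
move=> uv vw meet indR.
case: w wD vw => [i|[b|//]] wD vw; split.
- by rewrite !inE (negPf tD) andbF.
- right; split=> [a|x y xD yD xy]; first by rewrite !inE (negPf (lowD a)) andbF.
  apply: (sub_independent _ indR); apply/subsetP=> z.
  case/setDP=> /setU1P[->|//].
  move: xD yD xy; rewrite !inE => xD yD xy.
  have /independentP/(_ x y) := indR; rewrite !inE xy => indxy.
  case/orP: xD => [/eqP->|xD]; first by rewrite eqxx.
  case/orP: yD => [/eqP->|yD]; first by rewrite eqxx orbT.
  by have := indxy xD yD.
- by rewrite !inE (negPf tD) andbF.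
left; apply: independentU1 => // x; rewrite !inE => /andP[/norP[_ xv] xD].
case: x xv xD => [i|a] xv xD; last by rewrite (negPf (lowD a)) in xD.
move: vw => /= /eqP <-; apply: contra xv => /eqP->; exact: eqxx.
Qed.

Lemma safe_unreachable D : safe D -> target \notin reach D.
Proof.
move=> safeD; rewrite inE; apply/existsPn=> D'; apply/negP=> /andP[].
case/connectP=> s ps ->; elim: s D safeD ps => [|D1 s IH] D safeD /=.
  by case: safeD => /negPf->.
by case/andP=> /(safe_move safeD) /IH.
Qed.

(** The lower part without its hub: one peg more than the independence number. *)
Definition stuck_pegs : {set extremal} :=
  [set (inl (Some i) : extremal) | i in [set: 'I_3 + 'I_k]].

Lemma card_stuck_pegs : #|stuck_pegs| = k.+3.
Proof.
by rewrite card_imset => [|i j [->]] //; rewrite cardsT card_sum !card_ord.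
Qed.

(** Without the hub the only lower edges are the sides of the triangle, and any two of these meet.
    Subsets are allowed so that every smaller number of pegs is refuted too. *)
Lemma sub_stuck_safe (D : {set extremal}) : D \subset stuck_pegs -> safe D.
Proof.
move=> /subsetP sD; split; first by apply/negP=> /sD/imsetP[].
right; split=> [a|u v uD vD uv]; first by apply/negP=> /sD/imsetP[].
apply/independentP=> x y; rewrite !inE => /andP[xuv xD] /andP[yuv yD].
move: uv xuv yuv; case/imsetP: (sD _ uD) => {uD}u _ ->.
case/imsetP: (sD _ vD) => {vD}v _ ->; case/imsetP: (sD _ xD) => {xD}x _ ->.
case/imsetP: (sD _ yD) => {yD}y _ ->.
case: u v x y => [u|u] [v|v] [x|x] [y|y] //= uv xuv yuv; rewrite negbK.
have eqE (p q : 'I_3) :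
  ((inl (Some (inl p)) : extremal) == inl (Some (inl q))) = (p == q :> nat) by [].
move: uv xuv yuv; rewrite !eqE -!val_eqE /=.
by case: u v x y => [[|[|[|?]]] ?] [[|[|[|?]]] ?] [[|[|[|?]]] ?] [[|[|[|?]]] ?].
Qed.

Lemma extremal_pegging_number : pegging_number extremal = k.+2 + 2.
Proof.
apply/eqP; rewrite eqn_leq; apply/andP; split.
  rewrite -extremal_independence; apply: pegging_number_leq => x a b _.
  by left; apply: extremal_near2.
rewrite /pegging_number; case: ex_minnP => p /andP[_ /forallP boundp] _.
rewrite leqNgt addn2; apply/negP; rewrite ltnS => lep.
pose D : {set extremal} := [set x in take p (enum stuck_pegs)].
have /implyP := boundp D; rewrite cardsE.
have /card_uniqP-> : uniq (take p (enum stuck_pegs)) by rewrite take_uniq ?enum_uniq.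
rewrite size_take_min -cardE card_stuck_pegs (minn_idPl lep) eqxx => /(_ isT)/eqP rD.
have /safe_unreachable : safe D.
  apply: sub_stuck_safe; apply/subsetP=> x; rewrite inE => /mem_take.
  by rewrite mem_enum.
by rewrite rD in_setT.
Qed.

End Extremal.

Theorem theorem6p2 (alpha : nat) (alpha_ge2 : 2 <= alpha) :
  [/\ (* (i) *)
      [/\ forall G : sgraph,
            has_ve_diameter G 2 -> independence_number G = alpha ->
            pegging_number G <= alpha + 2,
          exists G : sgraph,
            [/\ has_diameter G 2, has_ve_diameter G 2,
                independence_number G = alpha
              & pegging_number G = alpha + 2]
        & is_max (fun p : nat => exists G : sgraph,
                    [/\ has_ve_diameter G 2, independence_number G = alpha
                      & pegging_number G = p])
                 (alpha + 2)],
      (* (ii) *)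
      (forall G : sgraph,
         has_ve_diameter G 2 -> independence_number G = alpha ->
         forall (D : {set G}) (t : G),
           alpha + 2 <= #|D| -> reachable_within t D 3)
    & (* (iii) *)
      forall G : sgraph,
        has_ve_diameter G 2 -> independence_number G = alpha ->
        pegging_number G = alpha + 2 ->
        induced_subgraph graphA G /\
        (has_diameter G 2 -> induced_subgraph graphB G)].
Proof.
have upper (G : sgraph) : has_ve_diameter G 2 -> independence_number G = alpha ->
    pegging_number G <= alpha + 2.
  by move=> /ve_diameter2_near near <-; apply: pegging_number_leq.
have [H [H1 H2 H3 H4]] : exists G : sgraph,
    [/\ has_diameter G 2, has_ve_diameter G 2,
        independence_number G = alpha & pegging_number G = alpha + 2].
  case: alpha alpha_ge2 {upper} => [|[|k]] // _; exists (extremal k); split.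
  - exact: extremal_diameter.
  - exact: extremal_ve_diameter.
  - exact: extremal_independence.
  - exact: extremal_pegging_number.
split; first split=> //.
- by exists H.
- split; first by exists H.
  by move=> p [G [veG aG <-]]; apply: upper.
- by move=> G /ve_diameter2_near near <- D t; apply: reach_in3.
move=> G /ve_diameter2_near near <- pG.
have [inA inB] := contains_AB near pG; split=> // dG; apply: inB => x y.
exact: diameter2_near.
Qed.
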